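(* Assume that the measurements $(Y,\Phi)$ are such that $\Gamma=\mathcal{Z}(N)$ with $N_{22}<0$. Then $U(\cdot;\Gamma)$ is convex if each basis function $\phi_i$, $i=1,\dots,k$, is convex and $-N_{22}^{-1}b(z)\geq 0$ (elementwise) for all $z\in\mathbb{R}^n$.
   Context: Conventions: for a vector $v$, $v\geq 0$ means all entries are nonnegative. For a symmetric matrix $P$, $P\geq 0$ (resp. $P>0$) means positive semidefinite (resp. definite); $P<0$ means $-P>0$. Let $\phi_1,\dots,\phi_k:\mathbb{R}^n\to\mathbb{R}$ be known basis functions, $b(z):=(\phi_1(z),\dots,\phi_k(z))^\top\in\mathbb{R}^k$, and for $\gamma\in\mathbb{R}^k$ let $\phi^\gamma(z):=\gamma^\top b(z)$. For a symmetric matrix $\Pi=\begin{bmatrix}\Pi_{11}&\Pi_{12}\\ \Pi_{21}&\Pi_{22}\end{bmatrix}\in\mathbb{R}^{(1+\ell)\times(1+\ell)}$ with $\Pi_{11}\in\mathbb{R}$, $\Pi_{22}\in\mathbb{R}^{\ell\times\ell}$, define $\mathcal{Z}(\Pi):=\{v\in\mathbb{R}^\ell \mid \begin{bmatrix}1\\ v\end{bmatrix}^\top\Pi\begin{bmatrix}1\\ v\end{bmatrix}\geq 0\}$; if $\Pi_{22}<0$, the Schur complement is $\Pi|\Pi_{22}:=\Pi_{11}-\Pi_{12}\Pi_{22}^{-1}\Pi_{21}$. Measurements: fix points $z_1,\dots,z_T\in\mathbb{R}^n$ and put $\Phi:=[\,b(z_1)\ \cdots\ b(z_T)\,]\in\mathbb{R}^{k\times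 T}$. There is an unknown true parameter $\hat\gamma\in\mathbb{R}^k$ and an unknown noise $W\in\mathbb{R}^{1\times T}$ such that the measured data satisfy $Y=\hat\gamma^\top\Phi+W\in\mathbb{R}^{1\times T}$. Standing noise assumption: $\Pi\in\mathbb{R}^{(1+T)\times(1+T)}$ is symmetric with $\Pi_{22}<0$ and $\Pi|\Pi_{22}\geq 0$, and $W^\top\in\mathcal{Z}(\Pi)$. The set of parameters consistent with the measurements is $\Gamma:=\{\gamma\in\mathbb{R}^k\mid Y=\gamma^\top\Phi+W' \text{ for some } W' \text{ with } (W')^\top\in\mathcal{Z}(\Pi)\}$. It equals $\mathcal{Z}(N)$, where $$N=\begin{bmatrix}N_{11}&N_{12}\\N_{21}&N_{22}\end{bmatrix}:=\begin{bmatrix}1&Y\\0&-\Phi\end{bmatrix}\Pi\begin{bmatrix}1&Y\\0&-\Phi\end{bmatrix}^\top\in\mathbb{R}^{(1+k)\times(1+k)},$$ partitioned with $N_{11}\in\mathbb{R}$, $N_{22}\in\mathbb{R}^{k\times k}$. In particular $\hat\gamma\in\Gamma$. Define $\phi^+(z;\Gamma):=\sup_{\gamma\in\Gamma}\phi^\gamma(z)$, $\phi^-(z;\Gamma):=\inf_{\gamma\in\Gamma}\phi^\gamma(z)$, and the uncertainty at $z$, $U(z;\Gamma):=\phi^+(z;\Gamma)-\phi^-(z;\Gamma)$. *)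

(* Defs.v *)
From HB Require Import structures.
From mathcomp Require Import all_boot all_order all_algebra.
From mathcomp Require Import all_classical all_reals all_analysis.
Set Implicit Arguments.
Unset Strict Implicit.
Unset Printing Implicit Defensive.
Import Order.TTheory GRing.Theory Num.Theory.
Local Open Scope classical_set_scope.
Local Open Scope ring_scope.

Definition posdefmx (R : realType) (m : nat) (P : 'M[R]_m) : Prop :=
  P^T = P /\ forall v : 'cV[R]_m, v != 0 -> 0 < (v^T *m P *m v) 0 0.

Definition negdefmx (R : realType) (m : nat) (P : 'M[R]_m) : Prop :=
  posdefmx (- P).

Definition nonneg_cV (R : realType) (m : nat) (v : 'cV[R]_m) : Prop :=
  forall i : 'I_m, 0 <= v i 0.

Definition QMIset (R : realType) (l : nat) (Pi : 'M[R]_(1 + l)) :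
    set 'cV[R]_l :=
  [set v | 0 <= ((col_mx 1%:M v)^T *m Pi *m col_mx 1%:M v) 0 0].

(* [Pi | Pi_22]; meant for [Pi_22] invertible, since [invmx] is the identity
   on singular matrices. *)
Definition schur_compl (R : realType) (l : nat) (Pi : 'M[R]_(1 + l)) : R :=
  (ulsubmx Pi - ursubmx Pi *m invmx (drsubmx Pi) *m dlsubmx Pi) 0 0.

Definition basis_vec (R : realType) (n k : nat) (phi : 'I_k -> 'cV[R]_n -> R)
    (z : 'cV[R]_n) : 'cV[R]_k :=
  \col_(i < k) phi i z.

Definition lin_comb (R : realType) (n k : nat) (phi : 'I_k -> 'cV[R]_n -> R)
    (gamma : 'cV[R]_k) (z : 'cV[R]_n) : R :=
  (gamma^T *m basis_vec phi z) 0 0.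

Definition data_mx (R : realType) (n k T : nat) (phi : 'I_k -> 'cV[R]_n -> R)
    (z : 'I_T -> 'cV[R]_n) : 'M[R]_(k, T) :=
  \matrix_(i < k, j < T) basis_vec phi (z j) i 0.

Definition consistent_set (R : realType) (k T : nat) (Y : 'rV[R]_T)
    (Phi : 'M[R]_(k, T)) (Pi : 'M[R]_(1 + T)) : set 'cV[R]_k :=
  [set gamma | exists W' : 'rV[R]_T,
     QMIset Pi W'^T /\ Y = gamma^T *m Phi + W'].

Definition Nmx (R : realType) (k T : nat) (Y : 'rV[R]_T)
    (Phi : 'M[R]_(k, T)) (Pi : 'M[R]_(1 + T)) : 'M[R]_(1 + k) :=
  block_mx 1%:M Y 0 (- Phi) *m Pi *m (block_mx 1%:M Y 0 (- Phi))^T.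

(* [sup] and [inf] are the real-valued operators, which default to 0 on sets
   that are empty or unbounded on the relevant side; they agree with the
   extended-real ones when [Gamma] is nonempty and bounded. *)
Definition phi_plus (R : realType) (n k : nat) (phi : 'I_k -> 'cV[R]_n -> R)
    (Gamma : set 'cV[R]_k) (z : 'cV[R]_n) : R :=
  sup [set lin_comb phi gamma z | gamma in Gamma].

Definition phi_minus (R : realType) (n k : nat) (phi : 'I_k -> 'cV[R]_n -> R)
    (Gamma : set 'cV[R]_k) (z : 'cV[R]_n) : R :=
  inf [set lin_comb phi gamma z | gamma in Gamma].

Definition uncertainty (R : realType) (n k : nat)
    (phi : 'I_k -> 'cV[R]_n -> R) (Gamma : set 'cV[R]_k) (z : 'cV[R]_n) : R :=
  phi_plus phi Gamma z - phi_minus phi Gamma z.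

(* Main.v *)
Require Import Defs.
From HB Require Import structures.
From mathcomp Require Import all_boot all_order all_algebra.
From mathcomp Require Import all_classical all_reals all_analysis.
From mathcomp Require Import ring.
Set Implicit Arguments.
Unset Strict Implicit.
Unset Printing Implicit Defensive.
Import Order.TTheory GRing.Theory Num.Theory.
Local Open Scope classical_set_scope.
Local Open Scope ring_scope.

(** Completing the square in the quadratic inequality that describes Gamma
    shows that Gamma is an ellipsoid for [M := - N22]: the parameters [v] with
    [qnorm M (v - c) <= r], where [c := invmx M *m N21] and [r ^+ 2] is the
    Schur complement of N ([QMIset_ellipsoid]).  That complement is nonnegative
    because the true parameter lies in Gamma.

    A linear functional [v |-> v^T *m b] ranges over this ellipsoid between
    [c^T *m b - r * qnorm (invmx M) b] and [c^T *m b + r * qnorm (invmx M) b].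
    Cauchy-Schwarz gives the bounds, and they are attained on the line through
    [c] in the direction [invmx M *m b] ([sup_ellipsoid], [inf_ellipsoid]).
    So the uncertainty at [z] is [2 * r * qnorm (invmx M) (b z)], and the centre
    drops out.

    It remains to see that [z |-> qnorm Q (b z)] is convex, for
    [Q := invmx M].  Let [b'] be a convex combination of [b x] and [b y] and
    [b] the value of the basis vector at the same combination of [x] and [y];
    convexity of the basis functions says [b <= b'] entrywise.  Since
    [Q *m b >= 0], which is half the gradient of [qnorm Q ^+ 2] at [b],
    [qnorm Q b ^+ 2 = bform Q b b <= bform Q b b'], and Cauchy-Schwarz on each
    part of [b'] leaves a factor [qnorm Q b] to cancel ([qnorm_le_conv]). *)

(** * Bilinear forms on column vectors *)

Definition bform (R : realType) (m : nat) (P : 'M[R]_m) (u v : 'cV[R]_m) : R :=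
  (u^T *m P *m v) 0 0.

Definition qnorm (R : realType) (m : nat) (P : 'M[R]_m) (v : 'cV[R]_m) : R :=
  Num.sqrt (bform P v v).

Section BilinearForm.
Variables (R : realType) (m : nat).
Implicit Types (P : 'M[R]_m) (u v w : 'cV[R]_m).

Lemma bformDl P u v w : bform P (u + v) w = bform P u w + bform P v w.
Proof. by rewrite /bform linearD !mulmxDl mxE. Qed.

Lemma bformDr P u v w : bform P w (u + v) = bform P w u + bform P w v.
Proof. by rewrite /bform mulmxDr mxE. Qed.

Lemma bformZl P a u v : bform P (a *: u) v = a * bform P u v.
Proof. by rewrite /bform linearZ /= -!scalemxAl mxE. Qed.

Lemma bformZr P a u v : bform P u (a *: v) = a * bform P u v.
Proof. by rewrite /bform -scalemxAr mxE. Qed.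

Lemma bformC P u v : P^T = P -> bform P u v = bform P v u.
Proof.
move=> Psym; rewrite /bform -[in LHS](trmxK (u^T *m P *m v)) mxE.
by rewrite !trmx_mul trmxK Psym mulmxA.
Qed.

Lemma dot_mulmx_bform P u v : (u^T *m (P *m v)) 0 0 = bform P u v.
Proof. by rewrite /bform mulmxA. Qed.

Lemma dotC u v : (u^T *m v) 0 0 = (v^T *m u) 0 0.
Proof. by have := bformC u v (trmx1 R m); rewrite /bform !mulmx1. Qed.

Lemma dot_ge0 u v : nonneg_cV u -> nonneg_cV v -> 0 <= (u^T *m v) 0 0.
Proof.
move=> u0 v0; rewrite mxE; apply: sumr_ge0 => i _.
by rewrite mxE mulr_ge0.
Qed.

End BilinearForm.

(** * Cauchy-Schwarz for a positive definite matrix *)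

Section PositiveDefinite.
Variables (R : realType) (m : nat) (P : 'M[R]_m).
Hypothesis Ppos : posdefmx P.
Implicit Types u v b : 'cV[R]_m.

Lemma posdef_bform_ge0 v : 0 <= bform P v v.
Proof.
have [->|v0] := eqVneq v 0; last exact: ltW (Ppos.2 v v0).
by rewrite /bform mulmx0 mxE.
Qed.

Lemma qnorm_sqr v : qnorm P v ^+ 2 = bform P v v.
Proof. by rewrite sqr_sqrtr // posdef_bform_ge0. Qed.

(** The form is nonnegative at
    [bform P v v *: u - bform P u v *: v], where it equals
    [bform P v v * (bform P u u * bform P v v - bform P u v ^+ 2)]. *)
Lemma posdef_cauchy_schwarz u v : bform P u v <= qnorm P u * qnorm P v.
Proof.
have [->|v0] := eqVneq v 0.
  by rewrite {1}/bform mulmx0 mxE mulr_ge0 // sqrtr_ge0.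
have q0 : 0 < bform P v v := Ppos.2 v v0.
have := posdef_bform_ge0 (bform P v v *: u + - bform P u v *: v).
rewrite !(bformDl, bformDr, bformZl, bformZr) (bformC v u Ppos.1) => disc.
have {disc} : 0 <= bform P v v * (bform P u u * bform P v v - bform P u v ^+ 2).
  by apply: le_trans disc _; rewrite le_eqVlt; apply/orP; left; apply/eqP; ring.
rewrite pmulr_rge0 // subr_ge0 => le_sqr.
rewrite -sqrtrM ?posdef_bform_ge0 //; apply: le_trans (ler_norm _) _.
by rewrite -sqrtr_sqr ler_wsqrtr.
Qed.

Lemma posdef_unitmx : P \in unitmx.
Proof.
rewrite -row_free_unit -kermx_eq0; apply/negPn/negP => /rowV0Pn[w /sub_kermxP wP w0].
have wT0 : w^T != 0 by rewrite -(inj_eq trmx_inj) trmxK trmx0.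
by have := Ppos.2 _ wT0; rewrite trmxK wP mul0mx mxE ltxx.
Qed.

Lemma bform_mulmx_inv u b : bform P u (invmx P *m b) = (u^T *m b) 0 0.
Proof. by rewrite -dot_mulmx_bform mulKVmx // posdef_unitmx. Qed.

Lemma bform_inv u v :
  bform (invmx P) u v = bform P (invmx P *m u) (invmx P *m v).
Proof.
by rewrite bform_mulmx_inv dotC dot_mulmx_bform bformC // trmx_inv Ppos.1.
Qed.

Lemma posdef_inv : posdefmx (invmx P).
Proof.
split=> [|v v0]; first by rewrite trmx_inv Ppos.1.
rewrite -/(bform _ v v) bform_inv; apply: Ppos.2.
apply: contra v0 => /eqP Pv0.
by rewrite -(mulKVmx posdef_unitmx v) Pv0 mulmx0.
Qed.

(** [qnorm P] and [qnorm (invmx P)] are dual norms. *)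
Lemma dot_le_qnorm u b : (u^T *m b) 0 0 <= qnorm P u * qnorm (invmx P) b.
Proof.
by rewrite -bform_mulmx_inv {2}/qnorm bform_inv posdef_cauchy_schwarz.
Qed.

(** Entries of [P *m b] are, up to a factor 2, the partial derivatives of
    [bform P] at [b]; their nonnegativity makes the quadratic form increase when
    [b] is replaced in one argument by the entrywise larger [t1 *: b1 + t2 *: b2].
    Cauchy-Schwarz then bounds both resulting terms by multiples of
    [qnorm P b], which cancels. *)
Lemma qnorm_le_conv b b1 b2 (t1 t2 : R) : 0 <= t1 -> 0 <= t2 ->
    nonneg_cV (P *m b) -> nonneg_cV (t1 *: b1 + t2 *: b2 - b) ->
  qnorm P b <= t1 * qnorm P b1 + t2 * qnorm P b2.
Proof.
move=> t1_ge0 t2_ge0 Pb_ge0 le_b.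
have [->|qb_neq0] := eqVneq (qnorm P b) 0.
  by rewrite addr_ge0 // mulr_ge0 // sqrtr_ge0.
have qb_gt0 : 0 < qnorm P b by rewrite lt_neqAle eq_sym qb_neq0 sqrtr_ge0.
rewrite -(ler_pM2l qb_gt0) -expr2 qnorm_sqr.
have le_bform : bform P b b <= bform P b (t1 *: b1 + t2 *: b2).
  rewrite -subr_ge0; have := dot_ge0 Pb_ge0 le_b.
  by rewrite trmx_mul Ppos.1 -/(bform P b _) -scaleN1r bformDr bformZr mulN1r.
apply: le_trans le_bform _; rewrite bformDr !bformZr mulrDr.
by rewrite lerD // mulrCA ler_wpM2l // posdef_cauchy_schwarz.
Qed.

End PositiveDefinite.

(** * Extreme values of a linear functional on an ellipsoid *)

Definition ellipsoid (R : realType) (m : nat) (P : 'M[R]_m) (c : 'cV[R]_m)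
    (r : R) : set 'cV[R]_m :=
  [set v | qnorm P (v - c) <= r].

Section EllipsoidWidth.
Variables (R : realType) (m : nat) (P : 'M[R]_m) (c : 'cV[R]_m) (r : R).
Hypotheses (Ppos : posdefmx P) (r_ge0 : 0 <= r).

Let values (b : 'cV[R]_m) := [set (v^T *m b) 0 0 | v in ellipsoid P c r].

Lemma ellipsoid_dot_le b v : ellipsoid P c r v ->
  (v^T *m b) 0 0 <= (c^T *m b) 0 0 + r * qnorm (invmx P) b.
Proof.
move=> vE; rewrite -lerBlDl.
have -> : (v^T *m b) 0 0 - (c^T *m b) 0 0 = ((v - c)^T *m b) 0 0.
  by rewrite linearB mulmxBl !mxE.
apply: le_trans (dot_le_qnorm Ppos _ _) _.
by rewrite ler_wpM2r // sqrtr_ge0.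
Qed.

(** The maximiser is the centre moved along the [P]-gradient [invmx P *m b] of
    the functional, up to the boundary.  For [b = 0] the step [r / q] is 0, as
    [q = 0] has inverse 0, and the maximiser is the centre itself. *)
Lemma ellipsoid_dot_attained b :
  values b ((c^T *m b) 0 0 + r * qnorm (invmx P) b).
Proof.
have Qpos := posdef_inv Ppos.
set q := qnorm (invmx P) b.
have q_ge0 : 0 <= q by exact: sqrtr_ge0.
exists (c + (r / q) *: (invmx P *m b)); last first.
  rewrite linearD mulmxDl mxE dotC linearZ /= -scalemxAl [X in _ + X]mxE.
  rewrite [in X in _ + X]dotC dot_mulmx_bform -(qnorm_sqr Qpos) -/q dotC.
  by have [->|q0] := eqVneq q 0; [rewrite expr0n /= !mulr0|congr (_ + _); field].
rewrite /ellipsoid /= addrC addKr /qnorm bformZl bformZr -bform_inv //.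
rewrite -(qnorm_sqr Qpos) -/q.
have -> : r / q * (r / q * q ^+ 2) = (r / q * q) ^+ 2 by ring.
rewrite sqrtr_sqr ger0_norm ?mulr_ge0 ?invr_ge0 //.
by have [->|q0] := eqVneq q 0; [rewrite mulr0|rewrite divfK].
Qed.

Lemma sup_ellipsoid b :
  sup (values b) = (c^T *m b) 0 0 + r * qnorm (invmx P) b.
Proof.
have ub : ubound (values b) ((c^T *m b) 0 0 + r * qnorm (invmx P) b).
  by move=> _ [v vE <-]; exact: ellipsoid_dot_le.
have att := ellipsoid_dot_attained b.
apply/eqP; rewrite eq_le ge_sup //=; last by eexists; exact: att.
by apply: ub_le_sup => //; eexists; exact: ub.
Qed.

Lemma inf_ellipsoid b :
  inf (values b) = (c^T *m b) 0 0 - r * qnorm (invmx P) b.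
Proof.
have qN : qnorm (invmx P) (- b) = qnorm (invmx P) b.
  by rewrite /qnorm -scaleN1r bformZl bformZr !mulN1r opprK.
have oppE (v : 'cV[R]_m) : (v^T *m - b) 0 0 = - (v^T *m b) 0 0.
  by rewrite mulmxN mxE.
rewrite /inf; have -> : [set - x | x in values b] = values (- b).
  apply/seteqP; split=> [_ [_ [v vE <-] <-]|_ [v vE <-]].
    by exists v.
  by exists ((v^T *m b) 0 0); [exists v|].
by rewrite sup_ellipsoid qN oppE opprD opprK.
Qed.

End EllipsoidWidth.

(** * Solution sets of quadratic inequalities as ellipsoids *)

Section QuadraticInequality.
Variables (R : realType) (l : nat) (N : 'M[R]_(1 + l)).
Hypotheses (Nsym : N^T = N) (N22neg : negdefmx (drsubmx N)).

Let M := - drsubmx N.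
Let c := invmx M *m dlsubmx N.

Lemma invmx_drsub : invmx (drsubmx N) = - invmx M.
Proof.
rewrite -[X in invmx X = _]opprK -/M -scaleN1r invmxZ.
  by rewrite invrN1 scaleN1r.
by rewrite unitmxZ ?unitrN1 // posdef_unitmx.
Qed.

(** The cross terms match because [bform M v c] is [v^T *m dlsubmx N], and the
    constant [bform M c c] is what the Schur complement adds to the upper left
    entry. *)
Lemma qmi_completed_square v :
  ((col_mx 1%:M v)^T *m N *m col_mx 1%:M v) 0 0
  = schur_compl N - bform M (v - c) (v - c).
Proof.
have ursub : ursubmx N = (dlsubmx N)^T by rewrite trmx_dlsub Nsym.
have cv : bform M v c = (v^T *m dlsubmx N) 0 0 by rewrite bform_mulmx_inv.
have cc : bform M c c = (ursubmx N *m invmx M *m dlsubmx N) 0 0.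
  by rewrite bform_mulmx_inv // dotC /c mulmxA ursub.
have addE (A B : 'M[R]_1) : (A + B) 0 0 = A 0 0 + B 0 0 by rewrite mxE.
have oppE (A : 'M[R]_1) : (- A) 0 0 = - A 0 0 by rewrite mxE.
have vv : (v^T *m drsubmx N *m v) 0 0 = - bform M v v.
  by rewrite /bform /M mulmxN mulNmx oppE opprK.
rewrite -[in LHS](submxK N) tr_col_mx mul_row_block mul_row_col trmx1.
rewrite !mul1mx !mulmx1 mulmxDl /schur_compl invmx_drsub.
rewrite -[v - c]/(v + - c) -(scaleN1r c) !(bformDl, bformDr, bformZl, bformZr).
rewrite (bformC c v N22neg.1) cv cc ursub.
rewrite mulmxN mulNmx opprK !addE vv (dotC (dlsubmx N)).
by ring.
Qed.

Lemma QMIset_schur_ge0 v : QMIset N v -> 0 <= schur_compl N.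
Proof.
rewrite /QMIset /= qmi_completed_square subr_ge0; apply: le_trans.
exact: posdef_bform_ge0.
Qed.

Lemma QMIset_ellipsoid : 0 <= schur_compl N ->
  QMIset N = ellipsoid M c (Num.sqrt (schur_compl N)).
Proof.
move=> s_ge0; apply/seteqP; split=> v; rewrite /QMIset /ellipsoid /= => vN.
  by rewrite ler_wsqrtr // -subr_ge0 -qmi_completed_square.
by rewrite qmi_completed_square subr_ge0 -ler_sqrt.
Qed.

End QuadraticInequality.

(** * Convexity of the uncertainty *)

Section Uncertainty.
Variables (R : realType) (n k : nat) (phi : 'I_k -> 'cV[R]_n -> R).
Variables (P : 'M[R]_k) (c : 'cV[R]_k) (r : R).
Hypotheses (Ppos : posdefmx P) (r_ge0 : 0 <= r).

Lemma uncertainty_ellipsoid z :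
  uncertainty phi (ellipsoid P c r) z
  = r *+ 2 * qnorm (invmx P) (basis_vec phi z).
Proof.
rewrite /uncertainty /phi_plus /phi_minus /lin_comb.
by rewrite sup_ellipsoid // inf_ellipsoid //; ring.
Qed.

Lemma uncertainty_ellipsoid_convex :
    (forall i, @convex_function R 'cV[R]_n [set: 'cV[R]_n] (phi i)) ->
    (forall z, nonneg_cV (invmx P *m basis_vec phi z)) ->
  @convex_function R 'cV[R]_n [set: 'cV[R]_n]
    (uncertainty phi (ellipsoid P c r)).
Proof.
move=> phi_convex Qb_ge0 t x y xT yT; rewrite convRE !uncertainty_ellipsoid.
rewrite !(mulrCA _ (r *+ 2)) -mulrDr ler_wpM2l ?mulrn_wge0 //.
apply: (qnorm_le_conv (posdef_inv Ppos)) => [||//|i].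
- exact: ge0.
- exact: unstable.onem_ge0.
- by rewrite !mxE subr_ge0; exact: phi_convex.
Qed.

End Uncertainty.

Theorem mainTheorem6 (R : realType) (n k T : nat)
    (phi : 'I_k -> 'cV[R]_n -> R) (z : 'I_T -> 'cV[R]_n)
    (gamma_hat : 'cV[R]_k) (W Y : 'rV[R]_T) (Pi : 'M[R]_(1 + T))
    (hY : Y = gamma_hat^T *m data_mx phi z + W)
    (hPi_sym : Pi^T = Pi)
    (hPi22 : negdefmx (drsubmx Pi))
    (hPi_schur : 0 <= schur_compl Pi)
    (hW : QMIset Pi W^T)
    (hGamma : consistent_set Y (data_mx phi z) Pi
              = QMIset (Nmx Y (data_mx phi z) Pi))
    (hN22 : negdefmx (drsubmx (Nmx Y (data_mx phi z) Pi)))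
    (hconv : forall i : 'I_k,
      @convex_function R 'cV[R]_n [set: 'cV[R]_n] (phi i))
    (hnonneg : forall x : 'cV[R]_n,
      nonneg_cV (- invmx (drsubmx (Nmx Y (data_mx phi z) Pi))
                 *m basis_vec phi x)) :
  @convex_function R 'cV[R]_n [set: 'cV[R]_n]
    (uncertainty phi (consistent_set Y (data_mx phi z) Pi)).
Proof.
set N := Nmx Y (data_mx phi z) Pi in hGamma hN22 hnonneg *.
have Nsym : N^T = N by rewrite /N /Nmx !trmx_mul trmxK hPi_sym mulmxA.
have hat_in : QMIset N gamma_hat by rewrite -hGamma; exists W.
rewrite hGamma QMIset_ellipsoid //; last exact: QMIset_schur_ge0 hat_in.
apply: uncertainty_ellipsoid_convex => // x.
by have := hnonneg x; rewrite invmx_drsub // opprK.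
Qed.
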